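(* Assume the setting and Assumptions (A1), (A2), (A3) in the context, and let $\eta>0$, $\zeta>\tfrac12$, $\rho\in(0,1)$ with $\alpha_0\le\frac{\rho(2\zeta-1)}{\zeta L_{\nabla f}\tilde B}$. Then there exist constants $C_1,C_2>0$ (independent of $K$) such that for all $K\ge1$ $$\min_{0\le k\le K-1}\mathbb{E}\|\nabla f(\theta^k)\|^2\le\frac{C_1}{K\alpha_K}+C_2L_K,\qquad L_K\coloneqq\frac{1}{K\alpha_K}\sum_{k=0}^{K-1}\alpha_k\epsilon_k^2 .$$ Moreover, if $\lim_{K\to\infty}L_K=0$, then $\lim_{K\to\infty}\min_{0\le k\le K-1}\mathbb{E}\|\nabla f(\theta^k)\|=0$.
   Context: Setting: $\theta\in\mathbb{R}^d$; $f_1,\dots,f_m:\mathbb{R}^d\to\mathbb{R}$, $f=\frac1m\sum_i f_i$. $\mathcal D$ is a distribution on $v\in\mathbb{R}^m$ with independent entries, $\mathbb{E}[v_i]=1$, $\mathbb{E}[v_i^2]<\infty$; $f_v=\frac1m\sum_iv_if_i$. Inexact stochastic gradient $z_v(\theta)=\nabla f_v(\theta)+e_v(\theta)$. Algorithm ISGD: deterministic $\theta^0$; for $k=0,1,\dots$ sample $v^k\sim\mathcal D$ independently of the past, $\theta^{k+1}=\theta^k-\alpha_kz_{v^k}(\theta^k)$, with positive step sizes $\alpha_k$ and non-negative accuracies $\epsilon_k$. (A1): each $f_i$ is $C^1$ with Lipschitz gradient and bounded below; $f$ has $L_{\nabla f}$-Lipschitz gradient and is bounded below by $f^{\inf}$;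 $A,B,C\ge0$ satisfy $\mathbb{E}_v\|\nabla f_v(\theta)\|^2\le2A(f(\theta)-f^{\inf})+B\|\nabla f(\theta)\|^2+C$ for all $\theta$. (A2): $\mathbb{E}[\|e_{v^k}(\theta^k)\|^2\mid\theta^k]\le\epsilon_k^2$ for all $k$, $\{\epsilon_k\}$ deterministic. (A3): $\{\alpha_k\}$ is positive and non-increasing, $\sum_{k}\alpha_k^2<\infty$, and $\lim_{k\to\infty}\frac{1}{k\alpha_k}=0$. Notation: $\tilde B=\frac{1+\eta}{\eta}B$. *)

(* Defs.v *)
From HB Require Import structures.
From mathcomp Require Import all_boot all_order all_algebra.
From mathcomp Require Import all_classical all_reals all_analysis.
Set Implicit Arguments. Unset Strict Implicit. Unset Printing Implicit Defensive.
Import Order.TTheory GRing.Theory Num.Theory.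
Import numFieldNormedType.Exports.
Local Open Scope classical_set_scope.
Local Open Scope ring_scope.

Section Defs.
Variable R : realType.

Definition dotp n (x y : 'rV[R]_n) : R := \sum_(j < n) x 0 j * y 0 j.
Definition sqnorm n (x : 'rV[R]_n) : R := \sum_(j < n) x 0 j ^+ 2.
Definition enorm n (x : 'rV[R]_n) : R := Num.sqrt (sqnorm x).

Definition is_gradient n (F : 'rV[R]_n -> R) (G : 'rV[R]_n -> 'rV[R]_n) :=
  forall x, differentiable F x /\ ('d F x : 'rV[R]_n -> R) = dotp (G x).

Definition euclid_lipschitz n (G : 'rV[R]_n -> 'rV[R]_n) (L : R) :=
  forall x y, enorm (G x - G y) <= L * enorm (x - y).

(** f = (1/m) sum_i f_i, its gradient, and the gradient of f_v *)
Definition favg m n (f : 'I_m -> 'rV[R]_n -> R) (x : 'rV[R]_n) : R :=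
  m%:R^-1 * \sum_(i < m) f i x.
Definition gavg m n (g : 'I_m -> 'rV[R]_n -> 'rV[R]_n) (x : 'rV[R]_n) :=
  m%:R^-1 *: \sum_(i < m) g i x.
Definition gradv m n (g : 'I_m -> 'rV[R]_n -> 'rV[R]_n) (v : 'rV[R]_m)
  (x : 'rV[R]_n) := m%:R^-1 *: \sum_(i < m) v 0 i *: g i x.

Definition borel_set (T : topologicalType) (A : set T) := <<s @open T >> A.
Definition borel_map (T U : topologicalType) (F : T -> U) :=
  forall B : set U, open B -> borel_set (F @^-1` B).

Section Prob.
Context d (Omega : measurableType d) (P : probability Omega R).

Definition mutually_independent (I : eqType) (X : I -> {RV P >-> R}) :=
  forall (J : seq I) (B : I -> set R), uniq J ->
    (forall j, j \in J -> measurable (B j)) ->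
    P [set w | forall j, j \in J -> B j (X j w)]
    = (\prod_(j <- J) P (X j @^-1` B j))%E.

Definition same_law (X Y : {RV P >-> R}) :=
  forall B : set R, measurable B -> P (X @^-1` B) = P (Y @^-1` B).

Definition vrow m (v : nat -> 'I_m -> {RV P >-> R}) k (w : Omega) : 'rV[R]_m :=
  \row_i v k i w.

Fixpoint isgd m n (g : 'I_m -> 'rV[R]_n -> 'rV[R]_n)
  (e : nat -> 'rV[R]_m -> 'rV[R]_n -> 'rV[R]_n)
  (v : nat -> 'I_m -> {RV P >-> R}) (alpha : nat -> R) (theta0 : 'rV[R]_n)
  (k : nat) (w : Omega) : 'rV[R]_n :=
  match k with
  | 0 => theta0
  | k'.+1 =>
    let th := isgd g e v alpha theta0 k' w in
    th - alpha k' *: (gradv g (vrow v k' w) th + e k' (vrow v k' w) th)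
  end.
End Prob.

Definition LK (alpha eps : nat -> R) (K : nat) : R :=
  (K%:R * alpha K)^-1 * \sum_(k < K) alpha k * eps k ^+ 2.
End Defs.

(* Main.v *)
Require Import Defs.
From HB Require Import structures.
From mathcomp Require Import all_boot all_order all_algebra.
From mathcomp Require Import all_classical all_reals all_analysis.
From mathcomp Require Import measurable_realfun ring lra.
Set Implicit Arguments. Unset Strict Implicit. Unset Printing Implicit Defensive.
Import Order.TTheory GRing.Theory Num.Theory.
Import numFieldNormedType.Exports.
Local Open Scope classical_set_scope.
Local Open Scope ring_scope.

(** The descent lemma bounds [f(theta^(k+1))] by a quadratic model at [theta^k].
    Young's inequality with parameter [zeta] absorbs the cross term between the
    gradient and the error, and Young's inequality with parameter [eta] splits
    [|grad f_v + e|^2].  Since [theta^k] is a Borel function of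
    [v^0, ..., v^(k-1)], it is independent of [v^k], so [grad f_v] has
    conditional mean [grad f] and its conditional second moment obeys the ABC
    bound; both facts only involve first and second moments of the entries of
    [v^k], because [grad f_v] is linear in [v].  The step size condition leaves
      r_(k+1) <= (1 + a alpha_k^2) r_k - c alpha_k E|grad f(theta^k)|^2
                 + q alpha_k^2 + D alpha_k eps_k^2
    for [r_k = E f(theta^k) - f_inf] with [c > 0].  As [sum alpha_k^2] is
    finite, Gronwall bounds [sum_(k<K) alpha_k E|grad f(theta^k)|^2], and
    monotonicity of [alpha] turns this weighted sum into a bound on the
    minimum. *)

(** * Borel maps between separable spaces *)

Definition separable (T : topologicalType) :=
  exists (I : countType) (s : I -> T), dense (range s).

Lemma separable_prod (T U : topologicalType) :
  separable T -> separable U -> separable (T * U)%type.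
Proof.
move=> [I [s ds]] [J [t dt]]; exists (I * J)%type, (fun k => (s k.1, t k.2)).
move=> W [[x y] Wxy] oW.
have [[A B] /= [nA nB] ABW] := open_nbhs_nbhs (conj oW Wxy).
have [||a [Aa [i _ ia]]] := ds A^°; [by exists x|exact: open_interior|].
have [||b [Bb [j _ jb]]] := dt B^°; [by exists y|exact: open_interior|].
exists (a, b); split; last by exists (i, j) => //=; rewrite ia jb.
by apply: ABW; split; exact: interior_subset.
Qed.

Lemma separable_mx (R : realType) m n : separable 'M[R]_(m, n).
Proof.
exists 'M[rat]_(m, n), (map_mx ratr) => W [M WM] oW.
have /nbhs_ballP[e /= e_gt0 eW] := open_nbhs_nbhs (conj oW WM).
have /choice[q qP] (ij : 'I_m * 'I_n) : exists q, ball (M ij.1 ij.2) e (ratr q).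
  have [||x [ex [q _ qx]]] := @dense_rat R (ball (M ij.1 ij.2) e).
  - by exists (M ij.1 ij.2); exact: ballxx.
  - exact: ball_open.
  - by exists q; rewrite qx.
exists (map_mx ratr (\matrix_(i, j) q (i, j))); split; last by eexists.
by apply: eW; split => // i j; rewrite !mxE; exact: (qP (i, j)).
Qed.

Lemma open_bigcup_balls (R : realType) (V : pseudoMetricType R) (I : Type)
    (s : I -> V) (U : set V) : dense (range s) -> open U ->
  U = \bigcup_(ik in [set ik | ball (s ik.1) ik.2.+1%:R^-1 `<=` U])
        ball (s ik.1) ik.2.+1%:R^-1.
Proof.
move=> ds oU; apply/seteqP; split => [x Ux|x [ik sU]]; last exact: sU.
have /nbhs_ballP[e /= e_gt0 eU] := open_nbhs_nbhs (conj oU Ux).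
have [|k] := @ltr_add_invr R 0 (e / 2); first by rewrite divr_gt0.
rewrite add0r => ke.
have k_gt0 : (0 : R) < k.+1%:R^-1 by rewrite invr_gt0.
have [||z [/interior_subset xz [i _ iz]]] := ds (ball x k.+1%:R^-1)^°.
- by exists x; exact: nbhsx_ballx.
- exact: open_interior.
exists (i, k) => /=; rewrite iz; last exact: ball_sym.
move=> y zy; apply: eU; rewrite [e]splitr; apply: ball_triangle.
  exact: le_ball (ltW ke) _ xz.
exact: le_ball (ltW ke) _ zy.
Qed.

Section BorelMeasurable.
Context (R : realType) (d : measure_display) (T : measurableType d).

Definition borel_measurable (V : topologicalType) (F : T -> V) :=
  forall U : set V, open U -> measurable (F @^-1` U).

Lemma borel_measurable_comp (V W : topologicalType) (h : V -> W) (F : T -> V) :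
  borel_map h -> borel_measurable F -> borel_measurable (h \o F).
Proof.
move=> bh mF U /bh; rewrite comp_preimage.
move: (h @^-1` U); apply: smallest_sub mF; split => /=.
- by rewrite preimage_set0.
- by move=> A mA; rewrite setTD preimage_setC; exact: measurableC.
- by move=> A mA; rewrite preimage_bigcup; exact: bigcupT_measurable.
Qed.

Lemma continuous_borel_map (V W : topologicalType) (h : V -> W) :
  continuous h -> borel_map h.
Proof.
move=> ch U oU; apply: sub_sigma_algebra.
by apply: open_comp => // x _; exact: ch.
Qed.

Lemma continuous_borel_measurable (V W : topologicalType) (h : V -> W)
    (F : T -> V) :
  continuous h -> borel_measurable F -> borel_measurable (fun t => h (F t)).
Proof.
by move=> ch; apply: borel_measurable_comp; exact: continuous_borel_map.
Qed.

Lemma borel_measurable_cst (V : topologicalType) (c : V) :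
  borel_measurable (cst c).
Proof. by move=> U oU; rewrite preimage_cst; case: ifP. Qed.

Lemma borel_measurableP (F : T -> R) :
  borel_measurable F <-> measurable_fun setT F.
Proof.
split=> mF.
  apply: (measurability _ (RGenOpens.measurableE R)).
  by move=> _ [_ [x [y ->]] <-]; rewrite setTI; apply: mF; exact: interval_open.
move=> U oU; rewrite -[_ @^-1` _]setTI.
by apply: mF => //; exact: open_measurable.
Qed.

Lemma borel_measurable_balls (V : pseudoMetricType R) (F : T -> V) :
  separable V -> (forall c r, 0 < r -> measurable (F @^-1` ball c r)) ->
  borel_measurable F.
Proof.
move=> [I [s ds]] mF U oU; rewrite (open_bigcup_balls ds oU) preimage_bigcup.
rewrite bigcup_mkcond; apply: countable_bigcupT_measurable => [|ik].
  exact: countableP.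
by case: ifP => // _; apply: mF; rewrite invr_gt0.
Qed.

Lemma borel_measurable_pair (V W : normedModType R) (F : T -> V) (G : T -> W) :
  separable V -> separable W -> borel_measurable F -> borel_measurable G ->
  borel_measurable (fun t => (F t, G t)).
Proof.
move=> sV sW mF mG; apply: borel_measurable_balls; first exact: separable_prod.
move=> [v w] r _.
apply: (measurableI (F @^-1` ball v r) (G @^-1` ball w r));
  [apply: mF|apply: mG]; exact: ball_open.
Qed.

Lemma borel_measurableD (V : normedModType R) (F G : T -> V) :
  separable V -> borel_measurable F -> borel_measurable G ->
  borel_measurable (fun t => F t + G t).
Proof.
move=> sV mF mG; have mFG := borel_measurable_pair sV sV mF mG.
exact: (continuous_borel_measurable (@add_continuous V) mFG).
Qed.

Lemma borel_measurableZ (V : normedModType R) (c : R) (F : T -> V) :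
  borel_measurable F -> borel_measurable (fun t => c *: F t).
Proof.
apply: continuous_borel_measurable => x.
by apply: continuousZl_tmp; exact: cvg_id.
Qed.

Lemma borel_measurable_mx m n (F : T -> 'M[R]_(m, n)) :
  (forall i j, measurable_fun setT (fun t => F t i j)) -> borel_measurable F.
Proof.
move=> mF; apply: borel_measurable_balls => [|c r r_gt0].
  exact: separable_mx.
rewrite (_ : _ @^-1` _ =
    \bigcap_ij ((fun t => F t ij.1 ij.2) @^-1` ball (c ij.1 ij.2) r)).
  apply: fin_bigcap_measurable => // ij _.
  by apply: (borel_measurableP _).2 => //; exact: ball_open.
apply/seteqP; split => t /=; first by move=> [_ h] ij _; exact: h.
by move=> h; split => // i j; exact: (h (i, j)).
Qed.

End BorelMeasurable.

(** * Independence *)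

Section TensorProduct.
Context d1 d2 (T1 : measurableType d1) (T2 : measurableType d2) (R : realType)
  (mu : {sigma_finite_measure set T1 -> \bar R})
  (nu : {sigma_finite_measure set T2 -> \bar R})
  (f : T1 -> R) (g : T2 -> R).
Hypotheses (intf : mu.-integrable setT (EFin \o f))
  (intg : nu.-integrable setT (EFin \o g)).
Local Open Scope ereal_scope.

Lemma integrable_tensor :
  (mu \x nu).-integrable setT (fun z => (f z.1 * g z.2)%:E).
Proof.
have /measurable_EFinP mf := measurable_int _ intf.
have /measurable_EFinP mg := measurable_int _ intg.
apply/integrable12ltyP.
  by apply/measurable_EFinP/measurable_funM; exact: measurableT_comp.
under eq_integral => x _.
  under eq_integral do rewrite /= normrM EFinM.
  rewrite ge0_integralZl//; last by do 2 apply: measurableT_comp.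
  over.
rewrite ge0_integralZr//; last 2 first.
  by do 2 apply: measurableT_comp.
  exact: integral_ge0.
have /integrableP[_ ?] := intf; have /integrableP[_ ?] := intg.
by rewrite lte_mul_pinfty ?integral_ge0// ge0_fin_numE// integral_ge0.
Qed.

Lemma integral_tensor : \int[mu \x nu]_z (f z.1 * g z.2)%:E =
  \int[mu]_x (f x)%:E * \int[nu]_y (g y)%:E.
Proof.
rewrite -(integral12_prod_meas1 integrable_tensor) /fubini_F /=.
under eq_integral => x _.
  under eq_integral do rewrite EFinM.
  rewrite integralZl//.
  over.
have /fineK <- : \int[nu]_y (g y)%:E \is a fin_num by exact: integrable_fin_num.
exact: integralZr.
Qed.

End TensorProduct.

Lemma eq_measure_integrable d (T : measurableType d) (R : realType)
    (mu nu : {measure set T -> \bar R}) (h : T -> \bar R) :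
  (forall A, measurable A -> mu A = nu A) ->
  mu.-integrable setT h -> nu.-integrable setT h.
Proof.
move=> munu /integrableP[mh muh]; apply/integrableP; split => //.
by rewrite (eq_measure_integral mu)// => A mA _; rewrite munu.
Qed.

Section Distribution.
Context (R : realType) (d : measure_display) (Omega : measurableType d)
  (P : probability Omega R).

Lemma integrable_distribution d' (T : measurableType d')
    (X : {mfun Omega >-> T}) (h : T -> \bar R) : measurable_fun setT h ->
  (distribution P X).-integrable setT h <-> P.-integrable setT (h \o X).
Proof.
move=> mh; have mabs : measurable_fun setT (abse \o h).
  exact: measurableT_comp.
have absE := ge0_integral_distribution X mabs (fun=> abse_ge0 _).
split=> /integrableP[_ hoo]; apply/integrableP; split=> //.
- exact: measurableT_comp.
- by rewrite /= in absE; rewrite -absE.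
- by rewrite [ltLHS]absE.
Qed.

Lemma same_law_Rintegral (X Y : {RV P >-> R}) (h : R -> R) :
  measurable_fun setT h -> same_law X Y -> (fun w => h (Y w)) \in Lfun P 1 ->
  (fun w => h (X w)) \in Lfun P 1 /\ \int[P]_w h (X w) = \int[P]_w h (Y w).
Proof.
move=> mh XY /Lfun1_integrable ihY.
have mEh : measurable_fun setT (EFin \o h) by exact/measurable_EFinP.
have lawE A : measurable A -> distribution P Y A = distribution P X A.
  by move=> mA; exact/esym/XY.
have dY := (integrable_distribution Y mEh).2 ihY.
have ihX := (integrable_distribution X mEh).1 (eq_measure_integrable lawE dY).
split; first exact/Lfun1_integrable.
congr fine; rewrite -[LHS](integral_distribution mEh ihX).
rewrite -[RHS](integral_distribution mEh ihY).
by apply: eq_measure_integral => A mA _; exact: XY.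
Qed.

End Distribution.

Section Independence.
Context (R : realType) (d : measure_display) (Omega : measurableType d)
  (P : probability Omega R).

Definition independent_classes (G H : set (set Omega)) :=
  forall A B, G A -> H B -> P (A `&` B) = (P A * P B)%E.

Lemma independent_classes_sym G H :
  independent_classes G H -> independent_classes H G.
Proof. by move=> GH A B HA GB; rewrite setIC muleC; exact: GH. Qed.

Lemma g_sigma_algebra_measurable (G : set (set Omega)) :
  G `<=` measurable -> <<s G >> `<=` measurable.
Proof. by apply: smallest_sub; exact: sigma_algebra_measurable. Qed.

Lemma independent_g_sigma_algebral (G H : set (set Omega)) :
  G `<=` measurable -> H `<=` measurable -> setI_closed G ->
  independent_classes G H -> independent_classes <<s G >> H.
Proof.
move=> mG mH GI indep A B sA HB; move: A sA.
have mB : measurable B := mH _ HB.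
have msG := g_sigma_algebra_measurable mG.
pose Q A := P (A `&` B) = (P A * P B)%E.
have QC (A : set Omega) : measurable A -> Q A -> Q (~` A).
  move=> mA QA; rewrite /Q setIC -setDE probability_setC//.
  have -> : P (B `\` A) = (P B - P (A `&` B))%E.
    by rewrite setIC measureD// -ge0_fin_numE// fin_num_measure.
  by rewrite QA muleBl ?mul1e// ?fin_num_adde_defr ?fin_num_measure.
have QU (F : (set Omega)^nat) : (forall k, measurable (F k)) ->
    trivIset setT F -> (forall k, Q (F k)) -> Q (\bigcup_k F k).
  move=> mF tF QF; rewrite /Q setI_bigcupl !measure_bigcup//=; last 2 first.
    by move=> k _; exact: measurableI.
    exact: trivIset_setIr.
  have /fineK PBE : P B \is a fin_num by exact: fin_num_measure.
  rewrite muleC -PBE -nneseriesZl//.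
  by apply: eq_eseriesr => k _; rewrite PBE muleC; exact: QF.
apply: (@dynkin_induction _ (g_sigma_algebraType G) G Q) => //.
- by rewrite /Q setTI probability_setT mul1e.
- by move=> A GA; exact: indep.
- by move=> A mA; exact: QC (msG _ mA).
- by move=> F mF; exact: QU (fun k => msG _ (mF k)).
Qed.

Lemma independent_g_sigma_algebra (G H : set (set Omega)) :
  G `<=` measurable -> H `<=` measurable -> setI_closed G -> setI_closed H ->
  independent_classes G H -> independent_classes <<s G >> <<s H >>.
Proof.
move=> mG mH GI HI indep; apply: independent_g_sigma_algebral => //.
  exact: g_sigma_algebra_measurable.
apply/independent_classes_sym/independent_g_sigma_algebral => //.
exact: independent_classes_sym.
Qed.

Definition independent_variables d1 d2 (T1 : measurableType d1)
    (T2 : measurableType d2) (X : Omega -> T1) (Y : Omega -> T2) :=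
  forall A B, measurable A -> measurable B ->
    P ((X @^-1` A) `&` (Y @^-1` B)) = (P (X @^-1` A) * P (Y @^-1` B))%E.

Lemma independent_joint_distribution d1 d2 (T1 : measurableType d1)
    (T2 : measurableType d2) (X : {mfun Omega >-> T1})
    (Y : {mfun Omega >-> T2}) (XY : {mfun Omega >-> (T1 * T2)%type}) :
  (forall w, XY w = (X w, Y w)) -> independent_variables X Y ->
  forall A, measurable A ->
  (distribution P X \x distribution P Y)%E A = distribution P XY A.
Proof.
move=> XYE indep; apply: product_measure_unique => A B mA mB.
transitivity (P (X @^-1` A `&` Y @^-1` B)); last exact: indep.
by congr (P _); apply/seteqP; split => w; rewrite /preimage /= XYE.
Qed.

Lemma independent_mul (X Y : Omega -> R) : independent_variables X Y ->
  X \in Lfun P 1 -> Y \in Lfun P 1 ->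
  (fun w => X w * Y w) \in Lfun P 1 /\
  \int[P]_w (X w * Y w) = (\int[P]_w X w) * \int[P]_w Y w.
Proof.
move=> indep iX iY.
pose X' : {mfun Omega >-> R} := mfun_Sub (sub_Lfun_mfun iX).
pose Y' : {mfun Omega >-> R} := mfun_Sub (sub_Lfun_mfun iY).
have /Lfun1_integrable intX := iX; have /Lfun1_integrable intY := iY.
pose Z w := (X' w, Y' w).
have mZ : measurable_fun setT Z by exact: measurable_fun_pair.
pose XY : {mfun Omega >-> (R * R)%type} :=
  HB.pack Z (isMeasurableFun.Build _ _ _ _ Z mZ).
have joint := independent_joint_distribution (X := X') (Y := Y') (XY := XY)
  (fun=> erefl) indep.
have mid : measurable_fun setT (EFin \o @idfun R).
  by apply/measurable_EFinP; exact: measurable_id.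
have dX := (integrable_distribution P X' mid).2 intX.
have dY := (integrable_distribution P Y' mid).2 intY.
have dXY := eq_measure_integrable joint (integrable_tensor dX dY).
have mXY := measurable_int _ dXY.
have iXY := (integrable_distribution P XY mXY).1 dXY.
split; first exact/Lfun1_integrable.
rewrite /Rintegral -fineM; [|exact: integrable_fin_num..]; congr fine.
transitivity (\int[distribution P XY]_z (z.1 * z.2)%:E)%E.
  exact/esym/(integral_distribution mXY).
rewrite -(eq_measure_integral _ (fun A mA _ => joint A mA)).
apply: etrans (integral_tensor dX dY) _.
by congr (_ * _)%E; exact: (integral_distribution mid).
Qed.

End Independence.

Section FamilyGenerated.
Context (R : realType) (d : measure_display) (Omega : measurableType d)
  (P : probability Omega R) (I : eqType) (X : I -> {RV P >-> R}).
Implicit Types S : set I.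

Definition cylinders S : set (set Omega) :=
  [set E | exists (J : seq I) (B : I -> set R),
    [/\ uniq J, (forall j, j \in J -> S j), (forall j, measurable (B j)) &
        E = [set w | forall j, j \in J -> B j (X j w)]]].

Lemma cylinders_measurable S : cylinders S `<=` measurable.
Proof.
move=> _ [J [B [_ _ mB ->]]].
rewrite (_ : [set w | _] = \bigcap_(j in [set` J]) (X j @^-1` B j))//.
apply: fin_bigcap_measurable => // j _.
by rewrite -[_ @^-1` _]setTI; exact: measurable_funP.
Qed.

Lemma cylinders_setI_closed S : setI_closed (cylinders S).
Proof.
move=> _ _ [J1 [B1 [_ S1 mB1 ->]]] [J2 [B2 [_ S2 mB2 ->]]].
pose B j := (if j \in J1 then B1 j else setT) `&`
            (if j \in J2 then B2 j else setT).
exists (undup (J1 ++ J2)), B; split.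
- exact: undup_uniq.
- by move=> j; rewrite mem_undup mem_cat => /orP[/S1|/S2].
- by move=> j; apply: measurableI; case: ifPn.
- apply/seteqP; split => w /=.
    by move=> [h1 h2] j _; split; case: ifPn => // jJ; [exact: h1|exact: h2].
  move=> h; split => j jJ; have [] := h j; rewrite ?mem_undup ?mem_cat jJ//.
  by rewrite orbT.
Qed.

Lemma cylinders_subset S S' : S `<=` S' -> cylinders S `<=` cylinders S'.
Proof.
by move=> SS' _ [J [B [u SJ mB ->]]]; exists J, B; split => // j /SJ /SS'.
Qed.

Lemma cylinders_independent S S' : mutually_independent X -> S `&` S' = set0 ->
  independent_classes P (cylinders S) (cylinders S').
Proof.
move=> indX SS'0 _ _ [J [B [uJ SJ mB ->]]] [J' [B' [uJ' SJ' mB' ->]]].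
have JJ' j : j \in J' -> (j \in J) = false.
  move=> jJ'; apply/negP => jJ; suff : set0 j by [].
  by rewrite -SS'0; split; [exact: SJ|exact: SJ'].
pose C j := if j \in J then B j else B' j.
rewrite (_ : _ `&` _ = [set w | forall j, j \in J ++ J' -> C j (X j w)]).
  rewrite !indX//=.
  - rewrite big_cat /=; congr (_ * _)%E; apply: eq_big_seq => j jJ.
      by rewrite /C jJ.
    by rewrite /C JJ'.
  - by rewrite cat_uniq uJ uJ' andbT; apply/hasPn => j /JJ' ->.
  - by move=> j _; rewrite /C; case: ifP.
apply/seteqP; split => w /=.
  by move=> [h h'] j; rewrite mem_cat /C; case: ifP => [/h|_ /h'].
move=> h; split=> j jJ; have := h j.
  by rewrite mem_cat jJ /C jJ; exact.
by rewrite mem_cat jJ orbT /C JJ'//; exact.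
Qed.

(* [F] is measurable for the sigma-algebra generated by the [X j] with [j] in
   [S], of which [cylinders S] is a generating pi-system. *)
Definition determined_by S (V : topologicalType) (F : Omega -> V) :=
  borel_measurable (F : g_sigma_algebraType (cylinders S) -> V).

Lemma determined_by_measurable S (V : topologicalType) (F : Omega -> V) :
  determined_by S F -> borel_measurable F.
Proof.
move=> SF U oU; apply: g_sigma_algebra_measurable (SF U oU).
exact: cylinders_measurable.
Qed.

Lemma determined_byW S S' (V : topologicalType) (F : Omega -> V) :
  S `<=` S' -> determined_by S F -> determined_by S' F.
Proof.
move=> SS' SF U oU; apply: (sub_smallest2r _ (cylinders_subset SS')).
  exact: smallest_sigma_algebra.
exact: SF.
Qed.

Lemma determined_by_comp S (V W : topologicalType) (h : V -> W)
    (F : Omega -> V) :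
  borel_map h -> determined_by S F -> determined_by S (fun w => h (F w)).
Proof. exact: borel_measurable_comp. Qed.

Lemma determined_by_coord S j : S j -> determined_by S (X j).
Proof.
move=> Sj; apply/borel_measurableP => _ B mB; apply: sub_sigma_algebra.
exists [:: j], (fun=> B); split => // [k|]; first by rewrite inE => /eqP ->.
rewrite setTI; apply/seteqP; split => w /=.
  by move=> XB k; rewrite inE => /eqP ->.
by apply; rewrite inE.
Qed.

Lemma determined_by_independent S S' (F G : Omega -> R) :
  mutually_independent X -> S `&` S' = set0 ->
  determined_by S F -> determined_by S' G -> independent_variables P F G.
Proof.
move=> indX SS'0 /borel_measurableP SF /borel_measurableP SG A B mA mB.
have := independent_g_sigma_algebra (@cylinders_measurable S)
  (@cylinders_measurable S') (@cylinders_setI_closed S)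
  (@cylinders_setI_closed S') (cylinders_independent indX SS'0).
apply.
  by have := SF measurableT A mA; rewrite setTI.
by have := SG measurableT B mB; rewrite setTI.
Qed.

End FamilyGenerated.

(** * Euclidean geometry and the descent lemma *)

Section Euclidean.
Context (R : realType) (n : nat).
Implicit Types (x y z : 'rV[R]_n) (c : R).

Lemma dotpC x y : dotp x y = dotp y x.
Proof. by apply: eq_bigr => j _; rewrite mulrC. Qed.

Lemma dotpDl x y z : dotp (x + y) z = dotp x z + dotp y z.
Proof.
by rewrite /dotp -big_split; apply: eq_bigr => j _; rewrite mxE mulrDl.
Qed.

Lemma dotpDr x y z : dotp x (y + z) = dotp x y + dotp x z.
Proof. by rewrite dotpC dotpDl !(dotpC x). Qed.

Lemma dotpZl c x y : dotp (c *: x) y = c * dotp x y.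
Proof.
by rewrite /dotp mulr_sumr; apply: eq_bigr => j _; rewrite mxE mulrA.
Qed.

Lemma dotpZr c x y : dotp x (c *: y) = c * dotp x y.
Proof. by rewrite dotpC dotpZl dotpC. Qed.

Lemma dotp0l x : dotp 0 x = 0.
Proof. by rewrite -(scale0r 0) dotpZl mul0r. Qed.

Lemma dotp_suml (I : Type) (r : seq I) (F : I -> 'rV[R]_n) y :
  dotp (\sum_(i <- r) F i) y = \sum_(i <- r) dotp (F i) y.
Proof.
elim: r => [|i r IH]; first by rewrite !big_nil dotp0l.
by rewrite !big_cons dotpDl IH.
Qed.

Lemma dotp_sumr (I : Type) (r : seq I) (F : I -> 'rV[R]_n) y :
  dotp y (\sum_(i <- r) F i) = \sum_(i <- r) dotp y (F i).
Proof. by rewrite dotpC dotp_suml; apply: eq_bigr => i _; rewrite dotpC. Qed.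

Lemma sqnormE x : sqnorm x = dotp x x.
Proof. by apply: eq_bigr => j _; rewrite expr2. Qed.

Lemma sqnorm_ge0 x : 0 <= sqnorm x.
Proof. by apply: sumr_ge0 => j _; exact: sqr_ge0. Qed.

Lemma sqnormZ c x : sqnorm (c *: x) = c ^+ 2 * sqnorm x.
Proof. by rewrite !sqnormE dotpZl dotpZr mulrA expr2. Qed.

Lemma sqnormN x : sqnorm (- x) = sqnorm x.
Proof. by rewrite -scaleN1r sqnormZ sqrrN expr1n mul1r. Qed.

Lemma sqnormD x y : sqnorm (x + y) = sqnorm x + 2 * dotp x y + sqnorm y.
Proof. by rewrite !sqnormE dotpDl !dotpDr (dotpC y x); ring. Qed.

Lemma coord_le_sqnorm x j : x 0 j ^+ 2 <= sqnorm x.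
Proof.
by rewrite /sqnorm (bigD1 j)//= lerDl sumr_ge0// => k _; exact: sqr_ge0.
Qed.

Lemma enorm_ge0 x : 0 <= enorm x.
Proof. exact: sqrtr_ge0. Qed.

Lemma sqr_enorm x : enorm x ^+ 2 = sqnorm x.
Proof. by rewrite sqr_sqrtr// sqnorm_ge0. Qed.

Lemma enormZ c x : enorm (c *: x) = `|c| * enorm x.
Proof. by rewrite /enorm sqnormZ sqrtrM ?sqr_ge0// sqrtr_sqr. Qed.

Lemma normr_le_enorm x : `|x| <= enorm x.
Proof.
rewrite /Num.norm/= mx_normrE; apply: bigmax_le => [|[i j] _ /=].
  exact: enorm_ge0.
by rewrite ord1 -sqrtr_sqr; exact/ler_wsqrtr/coord_le_sqnorm.
Qed.

Lemma enorm_eq0 x : enorm x = 0 -> x = 0.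
Proof. by move=> x0; apply/eqP; rewrite -normr_le0 -x0 normr_le_enorm. Qed.

Lemma dotp_young c x y :
  0 < c -> 2 * dotp x y <= c * sqnorm x + c^-1 * sqnorm y.
Proof.
move=> c_gt0; have := sqnorm_ge0 (c *: x - y); rewrite sqnormD sqnormN sqnormZ.
rewrite -scaleN1r dotpZl dotpZr => square_ge0.
rewrite -(ler_pM2l c_gt0) -subr_ge0; move: square_ge0; congr (0 <= _).
by field; rewrite gt_eqF.
Qed.

Lemma sqnormD_le c x y : 0 < c ->
  sqnorm (x + y) <= (1 + c^-1) * sqnorm x + (1 + c) * sqnorm y.
Proof.
move=> c_gt0; have := dotp_young x y (c := c^-1).
by rewrite invr_gt0 invrK sqnormD => /(_ c_gt0); lra.
Qed.

Lemma dotp_le_enorm x y : dotp x y <= enorm x * enorm y.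
Proof.
have [/enorm_eq0 ->|x_neq0] := eqVneq (enorm x) 0.
  by rewrite dotp0l mulr_ge0// enorm_ge0.
have [/enorm_eq0 ->|y_neq0] := eqVneq (enorm y) 0.
  by rewrite dotpC dotp0l mulr_ge0// enorm_ge0.
have x_gt0 : 0 < enorm x by rewrite lt_def x_neq0 enorm_ge0.
have y_gt0 : 0 < enorm y by rewrite lt_def y_neq0 enorm_ge0.
have := dotp_young x y (divr_gt0 y_gt0 x_gt0).
rewrite -!sqr_enorm (_ : _ + _ = 2 * (enorm x * enorm y)).
  by rewrite ler_pM2l.
by field; rewrite x_neq0 y_neq0.
Qed.

Lemma dotp_continuous (T : topologicalType) (F G : T -> 'rV[R]_n) :
  continuous F -> continuous G -> continuous (fun t => dotp (F t) (G t)).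
Proof.
move=> cF cG; have coordF (H : T -> 'rV[R]_n) j : continuous H ->
    continuous (fun t => H t 0 j).
  move=> cH t; apply: (@continuous_comp _ _ _ H (fun x => x 0 j)).
    exact: cH.
  exact: coord_continuous.
apply: continuous_big => [|j _ t]; first exact: add_continuous.
by apply: continuousM; exact: coordF.
Qed.

Lemma sqnorm_continuous : continuous (@sqnorm R n).
Proof.
rewrite (_ : @sqnorm R n = fun x => dotp x x).
  by apply: dotp_continuous => x; exact: cvg_id.
by apply/funext => x; rewrite sqnormE.
Qed.

Lemma enorm_continuous : continuous (@enorm R n).
Proof.
move=> x; apply: (continuous_comp (f := @sqnorm R n) (g := Num.sqrt)).
  exact: sqnorm_continuous.
exact: sqrt_continuous.
Qed.

End Euclidean.

Section Lipschitz.
Context (R : realType) (n : nat).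
Implicit Types (G : 'rV[R]_n -> 'rV[R]_n) (L : R).

Lemma euclid_lipschitzW G L L' :
  L <= L' -> euclid_lipschitz G L -> euclid_lipschitz G L'.
Proof.
by move=> LL' GL x y; apply: le_trans (GL x y) _; rewrite ler_wpM2r// enorm_ge0.
Qed.

Lemma euclid_lipschitz_continuous G L : euclid_lipschitz G L -> continuous G.
Proof.
move=> GL x; apply/(@cvgrPdist_le _ _ _ (nbhs x)) => r r_gt0.
have : {for x, continuous (fun y : 'rV[R]_n => L * enorm (x - y))}.
  apply: continuousM; first exact: cst_continuous.
  apply: (continuous_comp (f := fun y : 'rV[R]_n => x - y)).
    by apply: continuousB; [exact: cst_continuous|exact].
  exact: enorm_continuous.
rewrite /prop_for /continuous_at subrr -(scale0r 0) enormZ normr0 mul0r mulr0.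
move=> /(@cvgrPdist_le _ _ _ (nbhs x)) /(_ r r_gt0); apply: filterS => y.
rewrite sub0r normrN => Le; apply: le_trans (normr_le_enorm _) _.
exact: le_trans (GL x y) (le_trans (ler_norm _) Le).
Qed.

Lemma sqnorm_lipschitz_le G L x : euclid_lipschitz G L ->
  sqnorm (G x) <= 2 * L ^+ 2 * sqnorm x + 2 * sqnorm (G 0).
Proof.
move=> GL; have := GL x 0; rewrite subr0 => Gx.
have {}Gx : sqnorm (G x - G 0) <= L ^+ 2 * sqnorm x.
  rewrite -!sqr_enorm -exprMn ler_sqr// nnegrE ?enorm_ge0//.
  exact: le_trans (enorm_ge0 _) Gx.
have := sqnormD_le (G x - G 0) (G 0) ltr01; rewrite subrK invr1; lra.
Qed.

End Lipschitz.

Section Descent.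
Context (R : realType) (n : nat).
Variables (F : 'rV[R]_n -> R) (G : 'rV[R]_n -> 'rV[R]_n) (L : R).
Hypothesis gradF : is_gradient F G.

Lemma is_gradient_continuous : continuous F.
Proof. by move=> x; apply: differentiable_continuous; exact: (gradF x).1. Qed.

Lemma is_derive_line (x h : 'rV[R]_n) (t : R) :
  is_derive t (1 : R) (fun s => F (x + s *: h)) (dotp (G (x + t *: h)) h).
Proof.
pose l (s : R) := x + s *: h.
have dl : is_diff t l ( *:%R^~ h) by apply: is_diff_eq; rewrite add0r.
have [dF dFE] := gradF (l t).
have dFl : differentiable (F \o l) t by exact: differentiable_comp.
split; first exact: diff_derivable.
by rewrite -[fun _ => _]/(F \o l) deriveE// diff_comp//= dFE diff_val scale1r.
Qed.

Hypothesis lipG : euclid_lipschitz G L.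

Lemma quadratic_upper_bound x h :
  F (x + h) <= F x + dotp (G x) h + L / 2 * sqnorm h.
Proof.
pose a := dotp (G x) h; pose b := L / 2 * sqnorm h.
pose phi (t : R) := F (x + t *: h) - (a * t + b * (t * t)).
have dphi t :
    is_derive t (1 : R) phi (dotp (G (x + t *: h)) h - (a + b * (2 * t))).
  have := is_derive_line x h t => dF.
  by apply: is_derive_eq; rewrite /GRing.scale/=; ring.
have : phi 1 <= phi 0.
  apply: (@ler0_derive1_le_cc R phi 0 1) => //;
    rewrite ?in_itv/= ?lexx ?ler01//.
  - move=> t; rewrite in_itv/= => /andP[t_gt0 _]; rewrite derive1E derive_val.
    have : dotp (G (x + t *: h) - G x) h <= L * t * sqnorm h.
      apply: le_trans (dotp_le_enorm _ _) _.
      apply: le_trans (ler_wpM2r (enorm_ge0 h) (lipG _ _)) _.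
      by rewrite addrC addKr enormZ gtr0_norm// -sqr_enorm expr2 !mulrA.
    rewrite dotpDl -scaleN1r dotpZl /a /b; lra.
  - by apply: derivable_within_continuous => t _; exact: ex_derive.
rewrite /phi scale0r scale1r addr0 /a /b; lra.
Qed.

(* Young's inequality with parameter [zeta] absorbs the inner product of the
   gradient with the error [b], and with parameter [eta] it splits
   [sqnorm (u + b)]. *)
Lemma inexact_descent x u b alpha zeta eta :
  0 <= L -> 0 <= alpha -> 0 < zeta -> 0 < eta ->
  F (x - alpha *: (u + b)) <= F x - alpha * dotp (G x) u
    + alpha / (2 * zeta) * sqnorm (G x)
    + (alpha * zeta / 2 + L / 2 * alpha ^+ 2 * (1 + eta)) * sqnorm b
    + L / 2 * alpha ^+ 2 * (1 + eta^-1) * sqnorm u.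
Proof.
move=> L_ge0 alpha_ge0 zeta_gt0 eta_gt0.
apply: le_trans (quadratic_upper_bound _ _) _.
rewrite -scaleNr dotpZr dotpDr sqnormZ sqrrN mulrA.
have cross : alpha * (- dotp (G x) b) <=
    alpha * ((2 * zeta)^-1 * sqnorm (G x) + zeta / 2 * sqnorm b).
  apply: ler_wpM2l => //.
  have := dotp_young (- G x) b (c := zeta^-1).
  rewrite invr_gt0 invrK invfM sqnormN -scaleN1r dotpZl => /(_ zeta_gt0).
  lra.
have square : L / 2 * alpha ^+ 2 * sqnorm (u + b) <= L / 2 * alpha ^+ 2 *
    ((1 + eta^-1) * sqnorm u + (1 + eta) * sqnorm b).
  by rewrite ler_wpM2l ?sqnormD_le// mulr_ge0 ?sqr_ge0// divr_ge0.
lra.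
Qed.

End Descent.

Section Average.
Context (R : realType) (m n : nat).
Implicit Types (f : 'I_m -> 'rV[R]_n -> R) (g : 'I_m -> 'rV[R]_n -> 'rV[R]_n).

Lemma is_gradient_favg f g :
  (forall i, is_gradient (f i) (g i)) -> is_gradient (favg f) (gavg g).
Proof.
move=> fg x.
have dsum (r : seq 'I_m) : is_diff x (fun y => \sum_(i <- r) f i y)
    (dotp (\sum_(i <- r) g i x)).
  elim: r => [|i r IH].
    under eq_fun do rewrite big_nil; rewrite big_nil.
    by apply: is_diff_eq; apply/funext => z; rewrite dotp0l.
  under eq_fun do rewrite big_cons; rewrite big_cons.
  have [df dE] := fg i x; have di : is_diff x (f i) (dotp (g i x)) by split.
  rewrite (_ : dotp _ = dotp (g i x) + dotp (\sum_(i <- r) g i x)).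
    exact: is_diffD.
  by apply/funext => z; rewrite dotpDl.
have [] : is_diff x (favg f) (dotp (gavg g x)); last by [].
rewrite (_ : dotp _ = m%:R^-1 *: dotp (\sum_i g i x)); first exact: is_diffZ.
by apply/funext => z; rewrite dotpZl.
Qed.

Lemma gradv_continuous g : (forall i, continuous (g i)) ->
  continuous (fun p : 'rV[R]_m * 'rV[R]_n => gradv g p.1 p.2).
Proof.
move=> cg p; apply: continuousZl_tmp; move: p.
apply: continuous_big => [|i _ p]; first exact: add_continuous.
apply: continuousZ.
  apply: (@continuous_comp _ _ _ fst (fun v : 'rV[R]_m => v 0 i)).
    exact: cvg_fst.
  exact: coord_continuous.
by apply: (@continuous_comp _ _ _ snd (g i)); [exact: cvg_snd|exact: cg].
Qed.

Lemma dotp_gavg_gradv g (v : 'rV[R]_m) x :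
  dotp (gavg g x) (gradv g v x) =
  \sum_i m%:R^-1 * (v 0 i * dotp (gavg g x) (g i x)).
Proof.
rewrite dotpZr dotp_sumr mulr_sumr.
by apply: eq_bigr => i _; rewrite dotpZr.
Qed.

Lemma sqnorm_gavg g x :
  sqnorm (gavg g x) = \sum_i m%:R^-1 * dotp (gavg g x) (g i x).
Proof. by rewrite sqnormE {2}/gavg dotpZr dotp_sumr mulr_sumr. Qed.

Lemma sqnorm_gradv g (v : 'rV[R]_m) x : sqnorm (gradv g v x) =
  \sum_(p : 'I_m * 'I_m)
    m%:R^-1 ^+ 2 * (v 0 p.1 * v 0 p.2 * dotp (g p.1 x) (g p.2 x)).
Proof.
rewrite -(pair_bigA _ (fun i j =>
  m%:R^-1 ^+ 2 * (v 0 i * v 0 j * dotp (g i x) (g j x)))) /=.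
rewrite sqnormZ sqnormE dotp_suml mulr_sumr; apply: eq_bigr => i _.
rewrite dotp_sumr mulr_sumr; apply: eq_bigr => j _.
by rewrite dotpZl dotpZr; ring.
Qed.

End Average.

(** * Integrability *)

Section Integrability.
Context (R : realType) (d : measure_display) (T : measurableType d)
  (P : probability T R).
Implicit Types X Y : T -> R.

Lemma Lfun_measurable p X : X \in Lfun P p -> measurable_fun setT X.
Proof. by move=> /sub_Lfun_mfun; rewrite inE. Qed.

Lemma EFin_Rintegral X :
  X \in Lfun P 1 -> (\int[P]_w (X w)%:E)%E = (\int[P]_w X w)%:E.
Proof. by move=> /Lfun1_integrable iX; rewrite fineK// integrable_fin_num. Qed.

Lemma Lfun1_RintegralD X Y : X \in Lfun P 1 -> Y \in Lfun P 1 ->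
  \int[P]_w (X w + Y w) = \int[P]_w X w + \int[P]_w Y w.
Proof.
by move=> /Lfun1_integrable iX /Lfun1_integrable iY; exact: RintegralD.
Qed.

Lemma Lfun1_RintegralZl c X :
  X \in Lfun P 1 -> \int[P]_w (c * X w) = c * \int[P]_w X w.
Proof. by move=> /Lfun1_integrable iX; exact: RintegralZl. Qed.

Lemma Lfun1_axpy c X Y : X \in Lfun P 1 -> Y \in Lfun P 1 ->
  (fun w => X w + c * Y w) \in Lfun P 1 /\
  \int[P]_w (X w + c * Y w) = \int[P]_w X w + c * \int[P]_w Y w.
Proof.
move=> iX iY; have icY : (fun w => c * Y w) \in Lfun P 1 by exact: rpredZ.
by split; [exact: rpredD|rewrite Lfun1_RintegralD// Lfun1_RintegralZl].
Qed.

Lemma Rintegral_prob_cst c : \int[P]_w c = c.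
Proof.
transitivity (c * fine (P setT)); first exact: Rintegral_cst.
by rewrite probability_setT mulr1.
Qed.

Lemma Lfun1_le_Rintegral X Y : X \in Lfun P 1 -> Y \in Lfun P 1 ->
  (forall w, X w <= Y w) -> \int[P]_w X w <= \int[P]_w Y w.
Proof.
by move=> /Lfun1_integrable iX /Lfun1_integrable iY XY; exact: le_Rintegral.
Qed.

Lemma Lfun1_sum (I : Type) (r : seq I) (X : I -> T -> R) :
  (forall i, X i \in Lfun P 1) -> (fun w => \sum_(i <- r) X i w) \in Lfun P 1.
Proof.
move=> iX; rewrite (_ : (fun w => _) = \sum_(i <- r) X i).
  exact: rpred_sum.
by apply/funext => w; rewrite fct_sumE.
Qed.

Lemma Lfun1_lincomb (I : Type) (r : seq I) (c : I -> R) (X : I -> T -> R) :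
  (forall i, X i \in Lfun P 1) ->
  (fun w => \sum_(i <- r) c i * X i w) \in Lfun P 1 /\
  \int[P]_w (\sum_(i <- r) c i * X i w) = \sum_(i <- r) c i * \int[P]_w X i w.
Proof.
move=> iX; have iS s : (fun w => \sum_(i <- s) c i * X i w) \in Lfun P 1.
  by apply: Lfun1_sum => i; exact: rpredZ.
split=> //; elim: r => [|i r IH].
  by under eq_Rintegral do rewrite big_nil; rewrite big_nil Rintegral_prob_cst.
under eq_Rintegral do rewrite big_cons.
by rewrite big_cons Lfun1_RintegralD ?Lfun1_RintegralZl ?IH//; exact: rpredZ.
Qed.

Lemma Lfun1_dominated X Y : measurable_fun setT X -> Y \in Lfun P 1 ->
  (forall w, `|X w| <= Y w) -> X \in Lfun P 1.
Proof.
move=> mX /Lfun1_integrable iY XY; apply/Lfun1_integrable.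
apply: le_integrable iY => //; first exact/measurable_EFinP.
by move=> w _ /=; rewrite lee_fin; exact: le_trans (XY w) (ler_norm _).
Qed.

Lemma ge0_Lfun1 X M : measurable_fun setT X -> (forall w, 0 <= X w) ->
  (\int[P]_w (X w)%:E <= M%:E)%E -> X \in Lfun P 1.
Proof.
move=> mX X_ge0 XM; apply/Lfun1_integrable/integrableP; split.
  exact/measurable_EFinP.
under eq_integral do rewrite gee0_abs ?lee_fin//.
exact: le_lt_trans XM (ltry _).
Qed.

Lemma ge0_Rintegral_le X M : (forall w, 0 <= X w) ->
  (\int[P]_w (X w)%:E <= M%:E)%E -> \int[P]_w X w <= M.
Proof.
move=> X_ge0 XM; rewrite -lee_fin /Rintegral fineK// ge0_fin_numE.
  exact: le_lt_trans XM (ltry _).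
by apply: integral_ge0 => w _; rewrite lee_fin.
Qed.

Lemma Lfun2_sqrP X : X \in Lfun P 2%:E <->
  measurable_fun setT X /\ (fun w => X w ^+ 2) \in Lfun P 1.
Proof.
split=> [iX|[mX /Lfun1_integrable/integrableP[_ iX]]].
  split; first exact: Lfun_measurable iX.
  exact/Lfun1_integrable/Lfun2_integrable_sqr.
rewrite inE; apply/andP; split; rewrite inE//= /finite_norm unlock poweR_lty//.
under eq_integral do rewrite /= powR_mulrn// -normrX -abse_EFin.
exact: iX.
Qed.

Lemma Lfun2_Lfun1 X : X \in Lfun P 2%:E -> X \in Lfun P 1.
Proof. by apply: Lfun_subset12; exact: fin_num_measure. Qed.

Lemma Rintegral_le_sqrt X : X \in Lfun P 2%:E ->
  \int[P]_w X w <= Num.sqrt (\int[P]_w X w ^+ 2).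
Proof.
move=> iX; have := variance_ge0 P X; rewrite varianceE// unlock.
have [_ isq] := (Lfun2_sqrP X).1 iX.
rewrite (EFin_Rintegral (Lfun2_Lfun1 iX)) (EFin_Rintegral isq).
rewrite -EFin_expe -EFinB lee_fin subr_ge0 => /ler_wsqrtr; rewrite sqrtr_sqr.
exact: le_trans (ler_norm _).
Qed.

Section Vectors.
Context (n : nat).
Implicit Types U V : T -> 'rV[R]_n.

Definition square_integrable U := forall j, (fun w => U w 0 j) \in Lfun P 2%:E.

Lemma square_integrable_cst (u : 'rV[R]_n) : square_integrable (cst u).
Proof. by move=> j; exact: (Lfun_cst P (u 0 j) 2). Qed.

Lemma square_integrableD U V : square_integrable U -> square_integrable V ->
  square_integrable (fun w => U w + V w).
Proof.
by move=> iU iV j; under eq_fun do rewrite mxE; apply: rpredD; rewrite ?lee1n.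
Qed.

Lemma square_integrableZ c U :
  square_integrable U -> square_integrable (fun w => c *: U w).
Proof.
by move=> iU j; under eq_fun do rewrite mxE; apply: rpredZ; rewrite ?lee1n.
Qed.

Lemma square_integrable_dotp U V : square_integrable U -> square_integrable V ->
  (fun w => dotp (U w) (V w)) \in Lfun P 1.
Proof. by move=> iU iV; apply: Lfun1_sum => j; exact: Lfun2_mul_Lfun1. Qed.

Lemma square_integrableP U : square_integrable U <->
  borel_measurable U /\ (fun w => sqnorm (U w)) \in Lfun P 1.
Proof.
split=> [iU|[mU iU] j].
  split.
    apply: borel_measurable_mx => i j; rewrite ord1.
    exact: Lfun_measurable (iU j).
  by under eq_fun do rewrite sqnormE; exact: square_integrable_dotp.
have mUj : measurable_fun setT (fun w => U w 0 j).
  apply/borel_measurableP.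
  apply: (continuous_borel_measurable (h := fun x : 'rV[R]_n => x 0 j)) mU.
  exact: coord_continuous.
apply/Lfun2_sqrP; split=> //; apply: Lfun1_dominated iU _ => [|w].
  exact: measurable_funX.
by rewrite ger0_norm ?sqr_ge0// coord_le_sqnorm.
Qed.

Lemma square_integrable_lipschitz (G : 'rV[R]_n -> 'rV[R]_n) L U :
  euclid_lipschitz G L -> square_integrable U ->
  square_integrable (fun w => G (U w)).
Proof.
move=> GL /square_integrableP[mU iU].
have mGU : borel_measurable (fun w => G (U w)).
  exact: continuous_borel_measurable (euclid_lipschitz_continuous GL) mU.
apply/square_integrableP; split => //.
apply: (Lfun1_dominated
  (Y := fun w => 2 * L ^+ 2 * sqnorm (U w) + 2 * sqnorm (G 0))).
- apply/borel_measurableP.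
  exact: continuous_borel_measurable (@sqnorm_continuous R n) mGU.
- by apply: rpredD; [exact: rpredZ|exact: Lfun_cst].
- by move=> w; rewrite ger0_norm ?sqnorm_ge0//; exact: sqnorm_lipschitz_le.
Qed.

Lemma Rintegral_enorm_le U : square_integrable U ->
  (fun w => enorm (U w)) \in Lfun P 1 /\
  \int[P]_w enorm (U w) <= Num.sqrt (\int[P]_w sqnorm (U w)).
Proof.
move=> /square_integrableP[mU iU].
have sqrE : (fun w => enorm (U w) ^+ 2) = fun w => sqnorm (U w).
  by apply/funext => w; rewrite sqr_enorm.
have iE : (fun w => enorm (U w)) \in Lfun P 2%:E.
  apply/Lfun2_sqrP; rewrite sqrE; split=> //; apply/borel_measurableP.
  exact: continuous_borel_measurable (@enorm_continuous R n) mU.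
by split; [exact: Lfun2_Lfun1|rewrite -sqrE; exact: Rintegral_le_sqrt].
Qed.

(* The lower bound [c] makes the descent inequality at [0] a two-sided bound. *)
Lemma lipschitz_gradient_Lfun1 (F : 'rV[R]_n -> R) (G : 'rV[R]_n -> 'rV[R]_n)
    L c U : is_gradient F G -> euclid_lipschitz G L -> (forall x, c <= F x) ->
  square_integrable U -> (fun w => F (U w) - c) \in Lfun P 1.
Proof.
move=> FG GL cF iU; have [mU isq] := (square_integrableP U).1 iU.
have idot : (fun w => dotp (G 0) (U w)) \in Lfun P 1.
  exact: square_integrable_dotp (square_integrable_cst _) iU.
have [ilinear _] := Lfun1_axpy 1 (Lfun_cst P (F 0 - c) 1) idot.
have [iquadratic _] := Lfun1_axpy (L / 2) ilinear isq.
apply: Lfun1_dominated iquadratic _ => [|w].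
  apply: measurable_funB => //; apply/borel_measurableP.
  exact: continuous_borel_measurable (is_gradient_continuous FG) mU.
rewrite ger0_norm ?subr_ge0//.
by have := quadratic_upper_bound FG GL 0 (U w); rewrite add0r /=; lra.
Qed.

End Vectors.

Definition expected_gap m n (f : 'I_m -> 'rV[R]_n -> R) (finf : R)
  (U : T -> 'rV[R]_n) := \int[P]_w (favg f (U w) - finf).

Definition expected_sqgrad m n (g : 'I_m -> 'rV[R]_n -> 'rV[R]_n)
  (U : T -> 'rV[R]_n) := \int[P]_w sqnorm (gavg g (U w)).

Lemma expected_sqgrad_ge0 m n (g : 'I_m -> 'rV[R]_n -> 'rV[R]_n) U :
  0 <= expected_sqgrad g U.
Proof. by apply: Rintegral_ge0 => w _; exact: sqnorm_ge0. Qed.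

End Integrability.

(** * Scalar recursions *)

Section Recursion.
Context (R : realType).

Lemma discrete_gronwall (r x beta b : nat -> R) :
  (forall k, 0 <= r k) -> (forall k, 0 <= x k) ->
  (forall k, 0 <= beta k) -> (forall k, 0 <= b k) ->
  (forall k, r k.+1 <= (1 + beta k) * r k - x k + b k) ->
  forall K : nat, r K + \sum_(k < K) x k <=
    expR (\sum_(k < K) beta k) * (r 0%N + \sum_(k < K) b k).
Proof.
move=> r_ge0 x_ge0 beta_ge0 b_ge0 step; elim=> [|K IH].
  by rewrite !big_ord0 expR0 mul1r !addr0.
rewrite !big_ord_recr/= expRD.
set X := \sum_(k < K) x k in IH *; set E := expR (\sum_(k < K) beta k) in IH *.
set T := r 0%N + _ in IH; rewrite [r 0%N + (_ + _)]addrA -/T addrA.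
have X_ge0 : 0 <= X by rewrite sumr_ge0.
have growth : 1 + beta K <= expR (beta K) by exact: expR_ge1Dx.
have E_ge1 : 1 <= E * expR (beta K).
  by rewrite -expRD -expR0 ler_expR addr_ge0// sumr_ge0.
have grow_past : (1 + beta K) * (r K + X) <= E * expR (beta K) * T.
  rewrite [E * _]mulrC -mulrA; apply: ler_pM => //; first by rewrite addr_ge0.
  by rewrite addr_ge0.
have grow_new : b K <= E * expR (beta K) * b K by rewrite ler_peMl.
have := step K; have : 0 <= beta K * X by rewrite mulr_ge0.
lra.
Qed.

Lemma step_size_absorption (L zeta eta rho step0 step A B C r G s : R) :
  0 <= L -> 0 < zeta -> 0 < eta -> 0 <= B -> 0 <= G -> 0 <= s ->
  0 <= step -> step <= step0 ->
  step0 * (zeta * L * ((1 + eta) / eta * B)) <= rho * (2 * zeta - 1) ->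
  r - step * G + step / (2 * zeta) * G
    + (step * zeta / 2 + L / 2 * step ^+ 2 * (1 + eta)) * s
    + L / 2 * step ^+ 2 * (1 + eta^-1) * (2 * A * r + B * G + C) <=
  (1 + L * (1 + eta^-1) * A * step ^+ 2) * r
    - (1 - rho) * (1 - (2 * zeta)^-1) * (step * G)
    + (L / 2 * (1 + eta^-1) * C * step ^+ 2
       + (zeta / 2 + L / 2 * step0 * (1 + eta)) * (step * s)).
Proof.
move=> L_ge0 zeta_gt0 eta_gt0 B_ge0 G_ge0 s_ge0 step_ge0 step_le.
rewrite mulrDl mul1r divff ?gt_eqF// [eta^-1 + 1]addrC => small.
have factor_ge0 : 0 <= 1 + eta^-1 by rewrite addr_ge0// invr_ge0 ltW.
have coefG : L / 2 * step * (1 + eta^-1) * B <= rho * (1 - (2 * zeta)^-1).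
  apply: (@le_trans _ _ (L / 2 * step0 * (1 + eta^-1) * B)).
    by rewrite ler_wpM2r// ler_wpM2r// ler_wpM2l// divr_ge0.
  have -> : L / 2 * step0 * (1 + eta^-1) * B =
      (2 * zeta)^-1 * (step0 * (zeta * L * ((1 + eta^-1) * B))).
    by field; rewrite !gt_eqF.
  have -> : rho * (1 - (2 * zeta)^-1) = (2 * zeta)^-1 * (rho * (2 * zeta - 1)).
    by field; rewrite gt_eqF.
  by rewrite ler_wpM2l// invr_ge0 mulr_ge0// ltW.
have absorbG := ler_wpM2r (mulr_ge0 step_ge0 G_ge0) coefG.
have absorbs : L / 2 * (1 + eta) * (step * s) * step <=
    L / 2 * (1 + eta) * (step * s) * step0.
  by rewrite ler_wpM2l// !mulr_ge0 ?divr_ge0 ?addr_ge0// ltW.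
by move: absorbG absorbs; move: ((2 * zeta)^-1) (eta^-1) => *; lra.
Qed.

(* Square summability of the step sizes keeps the accumulated growth factor
   bounded by [expR (a * S)]. *)
Lemma descent_recursion_bound (r G alpha eps : nat -> R) (a c q D S : R) :
  0 <= a -> 0 < c -> 0 <= q -> 0 <= D ->
  (forall k, 0 <= r k) -> (forall k, 0 <= G k) -> (forall k, 0 < alpha k) ->
  (forall K : nat, \sum_(k < K) alpha k ^+ 2 <= S) ->
  (forall k, r k.+1 <= (1 + a * alpha k ^+ 2) * r k - c * (alpha k * G k)
    + (q * alpha k ^+ 2 + D * (alpha k * eps k ^+ 2))) ->
  exists C1 C2 : R, [/\ 0 < C1, 0 < C2 & forall K : nat,
    \sum_(k < K) alpha k * G k <= C1 + C2 * \sum_(k < K) alpha k * eps k ^+ 2].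
Proof.
move=> a_ge0 c_gt0 q_ge0 D_ge0 r_ge0 G_ge0 alpha_gt0 sumS step.
have weight_ge0 k : 0 <= alpha k * eps k ^+ 2.
  by rewrite mulr_ge0 ?sqr_ge0// ltW.
have S_ge0 : 0 <= S by have := sumS 0; rewrite big_ord0.
have growth_gt0 := expR_gt0 (a * S).
exists (c^-1 * (expR (a * S) * (r 0%N + q * S)) + 1),
       (c^-1 * (expR (a * S) * D) + 1); split.
- by rewrite ltr_wpDl// !mulr_ge0 ?invr_ge0 ?addr_ge0 ?mulr_ge0// ltW.
- by rewrite ltr_wpDl// !mulr_ge0 ?invr_ge0// ltW.
move=> K; set s := \sum_(k < K) alpha k * eps k ^+ 2.
have s_ge0 : 0 <= s by exact: sumr_ge0.
have := discrete_gronwall (x := fun k => c * (alpha k * G k))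
  (beta := fun k => a * alpha k ^+ 2) r_ge0 _ _ _ step K.
rewrite -!mulr_sumr big_split/= -!mulr_sumr -/s => gronwall.
have {gronwall} : c * \sum_(k < K) alpha k * G k <=
    expR (a * S) * (r 0%N + q * S + D * s).
  apply: le_trans (le_trans (gronwall _ _ _) _).
  - by rewrite lerDr.
  - by move=> k; rewrite !mulr_ge0// ltW.
  - by move=> k; rewrite mulr_ge0 ?sqr_ge0.
  - by move=> k; rewrite addr_ge0// mulr_ge0 ?sqr_ge0.
  apply: ler_pM; first exact: expR_ge0.
  - by rewrite !addr_ge0 ?mulr_ge0// sumr_ge0// => k _; exact: sqr_ge0.
  - by rewrite ler_expR; exact: ler_wpM2l (sumS K).
  - by rewrite addrA lerD2r lerD2l; exact: ler_wpM2l (sumS K).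
rewrite -ler_pdivlMl// => /le_trans; apply.
rewrite -subr_ge0 (_ : _ - _ = 1 + s); [by rewrite addr_ge0|ring].
Qed.

Lemma sum_le_lim_series (u : nat -> R) : (forall k, 0 <= u k) ->
  cvg (series u @ \oo) -> forall K : nat, \sum_(k < K) u k <= limn (series u).
Proof.
move=> u_ge0 cvg_u K; rewrite -(big_mkord xpredT u).
apply: nondecreasing_cvgn_le cvg_u K.
by apply: nondecreasing_series => k _ _.
Qed.

Lemma exists_le_weighted_mean (w u : nat -> R) (K : nat) (M : R) :
  (0 < K)%N -> (forall k, 0 < w k) -> (forall k, w k.+1 <= w k) ->
  (forall k, 0 <= u k) -> \sum_(k < K) w k * u k <= M ->
  exists k : 'I_K, u k <= M / (K%:R * w K).
Proof.
move=> K_gt0 w_gt0 wS_le u_ge0 sumM.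
pose i := [arg min_(k < Ordinal K_gt0) u k]%O; exists i.
have umin (k : 'I_K) : u i <= u k.
  by rewrite /i; case: arg_minP => // j _; exact.
rewrite ler_pdivlMr ?mulr_gt0 ?ltr0n//; apply: le_trans sumM.
rewrite mulrCA mulr_natl -[X in _ *+ X]card_ord -sumr_const mulrC.
apply: ler_sum => k _; apply: ler_pM => //; first exact: ltW.
by apply: (nonincreasing_seqP w).1 => //; exact: ltnW.
Qed.

Lemma bigmin_cvg0 (u : nat -> \bar R) (b : nat -> R) :
  (forall k, 0 <= u k)%E -> b @ \oo --> 0 ->
  (forall K, (0 < K)%N -> exists k : 'I_K, (u k <= (b K)%:E)%E) ->
  (fun K : nat => \big[mine/+oo]_(k < K) u k)%E @ \oo --> 0%E.
Proof.
move=> u_ge0 cvg_b ub.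
have cvg_bE : (b K)%:E @[K --> \oo] --> 0%E.
  by apply: cvg_EFin => //; exact: nearW.
have : \forall K \near \oo, (0 <= \big[mine/+oo]_(k < K) u k <= (b K)%:E)%E.
  exists 1%N => // K /= /ub[k ukb]; apply/andP; split; first exact: le_bigmin.
  exact: le_trans (bigmin_le _ k _) ukb.
by move=> /squeeze_cvge; apply => //; exact: cvg_cst.
Qed.

End Recursion.

(** * Stochastic gradients *)

Lemma coord_mul_continuous (R : realType) m (i j : 'I_m) :
  continuous (fun u : 'rV[R]_m => u 0 i * u 0 j).
Proof. by move=> u; apply: continuousM; exact: coord_continuous. Qed.

Section RandomWeights.
Context (R : realType) (d : measure_display) (Omega : measurableType d)
  (P : probability Omega R) (m : nat) (v : nat -> 'I_m -> {RV P >-> R}).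

Notation entry := (fun p : nat * 'I_m => v p.1 p.2).

Definition adapted (k : nat) (V : topologicalType) (F : Omega -> V) :=
  determined_by entry [set p | (p.1 < k)%N] F.

Lemma vrow_coord k i : (fun w => vrow v k w 0 i) = v k i.
Proof. by apply/funext => w; rewrite mxE. Qed.

Lemma determined_by_vrow k : determined_by entry [set p | p.1 = k] (vrow v k).
Proof.
apply: borel_measurable_mx => i j; rewrite ord1 vrow_coord.
by have /borel_measurableP := @determined_by_coord _ _ _ P _ entry
  [set p | p.1 = k] (k, j) erefl.
Qed.

Lemma adaptedS k (V : topologicalType) (F : Omega -> V) :
  adapted k F -> adapted k.+1 F.
Proof. by apply: determined_byW => p; exact: leqW. Qed.

Lemma adapted_vrow k : adapted k.+1 (vrow v k).
Proof. by apply: (determined_byW _ (@determined_by_vrow k)) => p /= ->. Qed.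

Hypothesis independent_v : mutually_independent entry.

Lemma vrow_independent_mul k (h : 'rV[R]_m -> R) (Y : Omega -> R) :
  continuous h -> (fun w => h (vrow v k w)) \in Lfun P 1 ->
  adapted k Y -> Y \in Lfun P 1 ->
  (fun w => h (vrow v k w) * Y w) \in Lfun P 1 /\
  \int[P]_w (h (vrow v k w) * Y w) = (\int[P]_w h (vrow v k w)) * \int[P]_w Y w.
Proof.
move=> ch ih aY; apply: independent_mul ih.
apply: (determined_by_independent (S := [set p | p.1 = k]) independent_v) aY.
  by apply/seteqP; split=> // p /= [->]; rewrite ltnn.
exact: determined_by_comp (continuous_borel_map ch) (@determined_by_vrow k).
Qed.

Hypothesis law_v : forall k i, same_law (v k i) (v 0 i).
Hypothesis mean_v : forall i, ('E_P[v 0%N i] = 1%:E)%E.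
Hypothesis sqr_v : forall i, P.-integrable setT (fun w => (v 0 i w ^+ 2)%:E).

Lemma vrow_Lfun2 k i : (fun w => vrow v k w 0 i) \in Lfun P 2%:E.
Proof.
rewrite vrow_coord; apply/Lfun2_sqrP; split; first exact: measurable_funP.
have msqr : measurable_fun setT (fun x : R => x ^+ 2).
  by apply: measurable_funX; exact: measurable_id.
have sqr0 : (fun w => v 0 i w ^+ 2) \in Lfun P 1.
  by apply/Lfun1_integrable; exact: sqr_v.
exact: (same_law_Rintegral msqr (law_v k i) sqr0).1.
Qed.

Lemma vrow_mean k i : \int[P]_w vrow v k w 0 i = 1.
Proof.
have := Lfun2_Lfun1 (vrow_Lfun2 0 i); rewrite !vrow_coord => iv0.
rewrite (same_law_Rintegral (@measurable_id _ _ _) (law_v k i) iv0).2.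
by have := mean_v i; rewrite unlock /Rintegral => ->.
Qed.

Lemma vrow_mul_Lfun1 k i j :
  (fun w => vrow v k w 0 i * vrow v k w 0 j) \in Lfun P 1.
Proof. exact: Lfun2_mul_Lfun1 (vrow_Lfun2 k i) (vrow_Lfun2 k j). Qed.

Lemma vrow_second_moment k i j :
  \int[P]_w (vrow v k w 0 i * vrow v k w 0 j) =
  \int[P]_w (vrow v 0 w 0 i * vrow v 0 w 0 j).
Proof.
have [<-|ij] := eqVneq i j.
  have msqr : measurable_fun setT (fun x : R => x * x).
    exact: measurable_funM.
  have sqrE l : (fun w => vrow v l w 0 i * vrow v l w 0 i) =
      fun w => v l i w * v l i w by apply/funext => w; rewrite mxE.
  have := vrow_mul_Lfun1 0 i i; rewrite !sqrE => isqr.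
  exact: (same_law_Rintegral msqr (law_v k i) isqr).2.
have uncorrelated l : \int[P]_w (vrow v l w 0 i * vrow v l w 0 j) = 1.
  have indep : independent_variables P (fun w => vrow v l w 0 i)
      (fun w => vrow v l w 0 j).
    rewrite !vrow_coord.
    apply: (determined_by_independent (S := [set (l, i)]) (S' := [set (l, j)])
      independent_v).
    - by apply/seteqP; split=> // p [-> [] /eqP]; rewrite (negbTE ij).
    - exact: (@determined_by_coord _ _ _ P _ entry _ (l, i)).
    - exact: (@determined_by_coord _ _ _ P _ entry _ (l, j)).
  have iL1 i' : (fun w => vrow v l w 0 i') \in Lfun P 1.
    exact: Lfun2_Lfun1 (vrow_Lfun2 l i').
  by rewrite (independent_mul indep (iL1 i) (iL1 j)).2 !vrow_mean mulr1.
by rewrite !uncorrelated.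
Qed.

Section Moments.
Context (n : nat) (g : 'I_m -> 'rV[R]_n -> 'rV[R]_n) (L : R).
Hypothesis lip_g : forall i, exists Li, euclid_lipschitz (g i) Li.
Hypothesis lip_gavg : euclid_lipschitz (gavg g) L.

Definition mean_sqgrad (x : 'rV[R]_n) : R :=
  \int[P]_w sqnorm (gradv g (vrow v 0 w) x).

Lemma mean_sqgradE x : mean_sqgrad x = \sum_(p : 'I_m * 'I_m)
  m%:R^-1 ^+ 2 * (\int[P]_w (vrow v 0 w 0 p.1 * vrow v 0 w 0 p.2)) *
  dotp (g p.1 x) (g p.2 x).
Proof.
pose c (p : 'I_m * 'I_m) := m%:R^-1 ^+ 2 * dotp (g p.1 x) (g p.2 x).
have [_ sumE] := Lfun1_lincomb (index_enum _) c
  (fun p => vrow_mul_Lfun1 0 p.1 p.2).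
transitivity (\int[P]_w \sum_p c p * (vrow v 0 w 0 p.1 * vrow v 0 w 0 p.2)).
  apply: eq_Rintegral => w _; rewrite sqnorm_gradv; apply: eq_bigr => p _.
  by rewrite /c; ring.
by rewrite sumE; apply: eq_bigr => p _; rewrite /c; ring.
Qed.

Variables (k : nat) (theta : Omega -> 'rV[R]_n).
Hypothesis adapted_theta : adapted k theta.
Hypothesis square_integrable_theta : square_integrable P theta.

Lemma gradient_continuous i : continuous (g i).
Proof. by have [Li /euclid_lipschitz_continuous] := lip_g i. Qed.

Lemma gradient_square_integrable i :
  square_integrable P (fun w => g i (theta w)).
Proof.
by have [Li gLi] := lip_g i; exact: square_integrable_lipschitz gLi _.
Qed.

Lemma gavg_square_integrable : square_integrable P (fun w => gavg g (theta w)).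
Proof. exact: square_integrable_lipschitz lip_gavg _. Qed.

Lemma sqnorm_gradv_expectation :
  [/\ (fun w => sqnorm (gradv g (vrow v k w) (theta w))) \in Lfun P 1,
      (fun w => mean_sqgrad (theta w)) \in Lfun P 1 &
      \int[P]_w sqnorm (gradv g (vrow v k w) (theta w)) =
      \int[P]_w mean_sqgrad (theta w)].
Proof.
pose D (p : 'I_m * 'I_m) w := dotp (g p.1 (theta w)) (g p.2 (theta w)).
have iD p : D p \in Lfun P 1.
  by apply: square_integrable_dotp; exact: gradient_square_integrable.
have aD p : adapted k (D p).
  apply: (determined_by_comp (h := fun x => dotp (g p.1 x) (g p.2 x)))
    adapted_theta.
  apply: continuous_borel_map.
  by apply: dotp_continuous; exact: gradient_continuous.
have vD (p : 'I_m * 'I_m) :=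
  vrow_independent_mul (@coord_mul_continuous _ _ p.1 p.2)
    (vrow_mul_Lfun1 k p.1 p.2) (aD p) (iD p).
have [isq sqE] := Lfun1_lincomb (index_enum _) (fun=> m%:R^-1 ^+ 2)
  (fun p => (vD p).1).
have [imean meanE] := Lfun1_lincomb (index_enum _)
  (fun p => m%:R^-1 ^+ 2 * \int[P]_w (vrow v 0 w 0 p.1 * vrow v 0 w 0 p.2)) iD.
rewrite (_ : (fun w => sqnorm _) = fun w => \sum_p m%:R^-1 ^+ 2 *
    (vrow v k w 0 p.1 * vrow v k w 0 p.2 * D p w)); last first.
  by apply/funext => w; rewrite sqnorm_gradv.
rewrite (_ : (fun w => mean_sqgrad _) = fun w => \sum_p m%:R^-1 ^+ 2 *
    (\int[P]_w (vrow v 0 w 0 p.1 * vrow v 0 w 0 p.2)) * D p w); last first.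
  by apply/funext => w; rewrite mean_sqgradE.
split=> //; rewrite sqE meanE; apply: eq_bigr => p _.
by rewrite (vD p).2 vrow_second_moment mulrA.
Qed.

Lemma dotp_gradv_expectation :
  (fun w => dotp (gavg g (theta w)) (gradv g (vrow v k w) (theta w)))
    \in Lfun P 1 /\
  \int[P]_w dotp (gavg g (theta w)) (gradv g (vrow v k w) (theta w)) =
  \int[P]_w sqnorm (gavg g (theta w)).
Proof.
pose Y i w := dotp (gavg g (theta w)) (g i (theta w)).
have iY i : Y i \in Lfun P 1.
  apply: square_integrable_dotp; first exact: gavg_square_integrable.
  exact: gradient_square_integrable.
have aY i : adapted k (Y i).
  apply: (determined_by_comp (h := fun x => dotp (gavg g x) (g i x)))
    adapted_theta.
  apply: continuous_borel_map; apply: dotp_continuous.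
    exact: euclid_lipschitz_continuous lip_gavg.
  exact: gradient_continuous.
have vY i := vrow_independent_mul (@coord_continuous _ _ _ 0 i)
  (Lfun2_Lfun1 (vrow_Lfun2 k i)) (aY i) (iY i).
have [idot dotE] := Lfun1_lincomb (index_enum _) (fun=> m%:R^-1)
  (fun i => (vY i).1).
have [_ sqE] := Lfun1_lincomb (index_enum _) (fun=> m%:R^-1) iY.
rewrite (_ : (fun w => dotp _ _) = fun w => \sum_i m%:R^-1 *
    (vrow v k w 0 i * Y i w)); last first.
  by apply/funext => w; rewrite dotp_gavg_gradv.
rewrite (_ : (fun w => sqnorm _) = fun w => \sum_i m%:R^-1 * Y i w); last first.
  by apply/funext => w; rewrite sqnorm_gavg.
split=> //; rewrite dotE sqE; apply: eq_bigr => i _.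
by rewrite (vY i).2 vrow_mean mul1r.
Qed.

Lemma adapted_vrow_pair : adapted k.+1 (fun w => (vrow v k w, theta w)).
Proof.
apply: borel_measurable_pair; [exact: separable_mx..|exact: adapted_vrow|].
exact: adaptedS.
Qed.

Lemma adapted_gradv : adapted k.+1 (fun w => gradv g (vrow v k w) (theta w)).
Proof.
apply: (determined_by_comp (h := fun p => gradv g p.1 p.2)) adapted_vrow_pair.
apply: continuous_borel_map; apply: gradv_continuous.
exact: gradient_continuous.
Qed.

Lemma gradv_square_integrable :
  square_integrable P (fun w => gradv g (vrow v k w) (theta w)).
Proof.
apply/square_integrableP; split; last by have [] := sqnorm_gradv_expectation.
exact: determined_by_measurable adapted_gradv.
Qed.

Lemma inexact_step_square_integrable (b : Omega -> 'rV[R]_n) step :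
  square_integrable P b -> square_integrable P
    (fun w => theta w - step *: (gradv g (vrow v k w) (theta w) + b w)).
Proof.
move=> ib; under eq_fun do rewrite -scaleNr.
apply: square_integrableD => //; apply: square_integrableZ.
exact: square_integrableD gradv_square_integrable ib.
Qed.

Section InexactStep.
Variables (f : 'I_m -> 'rV[R]_n -> R) (finf A B C : R).
Hypothesis gradient_f : forall i, is_gradient (f i) (g i).
Hypothesis finf_le : forall x, finf <= favg f x.
Hypothesis abc : forall x,
  (\int[P]_w (sqnorm (gradv g (vrow v 0 w) x))%:E
   <= (2 * A * (favg f x - finf) + B * sqnorm (gavg g x) + C)%:E)%E.

Lemma gap_Lfun1 (U : Omega -> 'rV[R]_n) :
  square_integrable P U -> (fun w => favg f (U w) - finf) \in Lfun P 1.
Proof.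
have gradient_favg := is_gradient_favg gradient_f.
exact: (lipschitz_gradient_Lfun1 gradient_favg lip_gavg finf_le).
Qed.

Lemma expected_mean_sqgrad_le : \int[P]_w mean_sqgrad (theta w) <=
  2 * A * expected_gap P f finf theta + B * expected_sqgrad P g theta + C.
Proof.
have igap := gap_Lfun1 square_integrable_theta.
have [_ isq] := (square_integrableP _ _).1 gavg_square_integrable.
have [int_gap int_gapE] := Lfun1_axpy (2 * A) (Lfun_cst P C 1) igap.
have [int_sq int_sqE] := Lfun1_axpy B int_gap isq.
have [_ imean _] := sqnorm_gradv_expectation.
rewrite [leRHS]addrC addrA -[X in X + _ + _](Rintegral_prob_cst P C).
rewrite -int_gapE -int_sqE.
apply: Lfun1_le_Rintegral => // w; rewrite -addrA addrC.
by apply: ge0_Rintegral_le (abc _) => w'; exact: sqnorm_ge0.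
Qed.

Variables (b : Omega -> 'rV[R]_n) (step eps zeta eta : R).
Hypothesis square_integrable_b : square_integrable P b.
Hypothesis sqnorm_b_le : \int[P]_w sqnorm (b w) <= eps ^+ 2.
Hypotheses (L_ge0 : 0 <= L) (step_ge0 : 0 <= step).
Hypotheses (zeta_gt0 : 0 < zeta) (eta_gt0 : 0 < eta).

Lemma expected_inexact_descent :
  expected_gap P f finf
    (fun w => theta w - step *: (gradv g (vrow v k w) (theta w) + b w)) <=
  expected_gap P f finf theta - step * expected_sqgrad P g theta
  + step / (2 * zeta) * expected_sqgrad P g theta
  + (step * zeta / 2 + L / 2 * step ^+ 2 * (1 + eta)) * eps ^+ 2
  + L / 2 * step ^+ 2 * (1 + eta^-1) *
      (2 * A * expected_gap P f finf theta + B * expected_sqgrad P g theta + C).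
Proof.
have grad_coef_ge0 : 0 <= L / 2 * step ^+ 2 * (1 + eta^-1).
  by rewrite !mulr_ge0 ?sqr_ge0 ?invr_ge0 ?addr_ge0 ?invr_ge0// ltW.
have err_coef_ge0 : 0 <= step * zeta / 2 + L / 2 * step ^+ 2 * (1 + eta).
  by rewrite addr_ge0 ?mulr_ge0 ?sqr_ge0 ?invr_ge0 ?addr_ge0// ltW.
have igap := gap_Lfun1 square_integrable_theta.
have [idot dotE] := dotp_gradv_expectation.
have [_ isq] := (square_integrableP _ _).1 gavg_square_integrable.
have [_ ib] := (square_integrableP _ _).1 square_integrable_b.
have [igrad _ gradE] := sqnorm_gradv_expectation.
have [int_dot int_dotE] := Lfun1_axpy (- step) igap idot.
have [int_sq int_sqE] := Lfun1_axpy (step / (2 * zeta)) int_dot isq.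
have [int_err int_errE] :=
  Lfun1_axpy (step * zeta / 2 + L / 2 * step ^+ 2 * (1 + eta)) int_sq ib.
have [int_grad int_gradE] :=
  Lfun1_axpy (L / 2 * step ^+ 2 * (1 + eta^-1)) int_err igrad.
apply: le_trans (Lfun1_le_Rintegral _ int_grad _) _.
- exact/gap_Lfun1/inexact_step_square_integrable.
- move=> w; have := inexact_descent (is_gradient_favg gradient_f) lip_gavg
    (theta w) (gradv g (vrow v k w) (theta w)) (b w) L_ge0 step_ge0 zeta_gt0
    eta_gt0.
  lra.
rewrite int_gradE int_errE int_sqE int_dotE dotE gradE mulNr.
apply: lerD; last exact: ler_wpM2l expected_mean_sqgrad_le.
by apply: lerD => //; exact: ler_wpM2l.
Qed.

End InexactStep.

End Moments.

(** * Inexact stochastic gradient descent *)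

Section Iterates.
Context (n : nat) (g : 'I_m -> 'rV[R]_n -> 'rV[R]_n)
  (e : nat -> 'rV[R]_m -> 'rV[R]_n -> 'rV[R]_n)
  (theta0 : 'rV[R]_n) (alpha eps : nat -> R) (L : R).

Notation theta := (isgd g e v alpha theta0).
Notation err k := (fun w => e k (vrow v k w) (theta k w)).

Hypothesis lip_g : forall i, exists Li, euclid_lipschitz (g i) Li.
Hypothesis lip_gavg : euclid_lipschitz (gavg g) L.
Hypothesis borel_e :
  forall k, borel_map (fun p : 'rV[R]_m * 'rV[R]_n => e k p.1 p.2).
Hypothesis sqnorm_err_le : forall k,
  (\int[P]_w (sqnorm (err k w))%:E <= (eps k ^+ 2)%:E)%E.

Lemma adapted_err k : adapted k (theta k) -> adapted k.+1 (err k).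
Proof.
move=> adapted_theta.
exact: (determined_by_comp (h := fun p => e k p.1 p.2) (borel_e k))
  (adapted_vrow_pair adapted_theta).
Qed.

Lemma isgd_adapted k : adapted k (theta k).
Proof.
elim: k => [|k IH]; first exact: borel_measurable_cst.
have -> : theta k.+1 = fun w =>
    theta k w + - alpha k *: (gradv g (vrow v k w) (theta k w) + err k w).
  by apply/funext => w /=; rewrite scaleNr.
apply: borel_measurableD; [exact: separable_mx|exact: adaptedS|].
apply: borel_measurableZ; apply: borel_measurableD; first exact: separable_mx.
- exact: adapted_gradv.
- exact: adapted_err.
Qed.

Lemma err_square_integrable k : square_integrable P (err k).
Proof.
have merr := determined_by_measurable (adapted_err (@isgd_adapted k)).
apply/square_integrableP; split=> //.
apply: ge0_Lfun1 (sqnorm_err_le k) => [|w]; last exact: sqnorm_ge0.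
apply/borel_measurableP.
exact: continuous_borel_measurable (@sqnorm_continuous R n) merr.
Qed.

Lemma isgd_square_integrable k : square_integrable P (theta k).
Proof.
elim: k => [|k IH]; first exact: square_integrable_cst.
apply: inexact_step_square_integrable => //; first exact: isgd_adapted.
exact: err_square_integrable.
Qed.

Lemma isgd_gradient_square_integrable k :
  square_integrable P (fun w => gavg g (theta k w)).
Proof.
exact: (gavg_square_integrable lip_gavg (@isgd_square_integrable k)).
Qed.

Section Convergence.
Context (f : 'I_m -> 'rV[R]_n -> R) (finf A B C eta zeta rho : R).
Hypothesis gradient_f : forall i, is_gradient (f i) (g i).
Hypothesis L_ge0 : 0 <= L.
Hypothesis finf_le : forall x, finf <= favg f x.
Hypotheses (A_ge0 : 0 <= A) (B_ge0 : 0 <= B) (C_ge0 : 0 <= C).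
Hypothesis abc : forall x,
  (\int[P]_w (sqnorm (gradv g (vrow v 0 w) x))%:E
   <= (2 * A * (favg f x - finf) + B * sqnorm (gavg g x) + C)%:E)%E.
Hypothesis alpha_gt0 : forall k, 0 < alpha k.
Hypothesis alphaS_le : forall k, alpha k.+1 <= alpha k.
Hypothesis cvg_sum_sqr_alpha : cvg (series (fun k => alpha k ^+ 2) @ \oo).
Hypotheses (eta_gt0 : 0 < eta) (zeta_gt : 2^-1 < zeta) (rho_lt1 : rho < 1).
Hypothesis alpha0_le :
  alpha 0 * (zeta * L * ((1 + eta) / eta * B)) <= rho * (2 * zeta - 1).

Notation gap k := (expected_gap P f finf (theta k)).
Notation sqgrad k := (expected_sqgrad P g (theta k)).

Lemma isgd_expected_descent k : gap k.+1 <=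
  (1 + L * (1 + eta^-1) * A * alpha k ^+ 2) * gap k
  - (1 - rho) * (1 - (2 * zeta)^-1) * (alpha k * sqgrad k)
  + (L / 2 * (1 + eta^-1) * C * alpha k ^+ 2
     + (zeta / 2 + L / 2 * alpha 0 * (1 + eta)) * (alpha k * eps k ^+ 2)).
Proof.
have zeta_gt0 : 0 < zeta by apply: lt_trans zeta_gt; rewrite invr_gt0.
have err_le : \int[P]_w sqnorm (err k w) <= eps k ^+ 2.
  by apply: ge0_Rintegral_le (sqnorm_err_le k) => w; exact: sqnorm_ge0.
apply: le_trans (expected_inexact_descent lip_g lip_gavg (@isgd_adapted k)
  (isgd_square_integrable k) gradient_f finf_le abc (err_square_integrable k)
  err_le L_ge0 (ltW (alpha_gt0 k)) zeta_gt0 eta_gt0) _.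
apply: step_size_absorption alpha0_le => //; rewrite ?sqr_ge0//.
- exact: expected_sqgrad_ge0.
- exact: ltW.
- by apply: (nonincreasing_seqP alpha).1.
Qed.

Lemma isgd_exists_small_gradient : exists C1 C2 : R, [/\ 0 < C1, 0 < C2 &
  forall K : nat, (0 < K)%N -> exists k : 'I_K,
    sqgrad k <= C1 / (K%:R * alpha K) + C2 * LK alpha eps K].
Proof.
have zeta_gt0 : 0 < zeta by apply: lt_trans zeta_gt; rewrite invr_gt0.
have sum_sqr_le := sum_le_lim_series (fun k => sqr_ge0 (alpha k))
  cvg_sum_sqr_alpha.
have eta_factor_ge0 : 0 <= 1 + eta^-1 by rewrite addr_ge0// invr_ge0 ltW.
have growth_ge0 : 0 <= L * (1 + eta^-1) * A by rewrite !mulr_ge0.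
have decrease_gt0 : 0 < (1 - rho) * (1 - (2 * zeta)^-1).
  have two_zeta_gt1 : 1 < 2 * zeta by rewrite mulrC -ltr_pdivrMr// mul1r.
  by apply: mulr_gt0; rewrite subr_gt0// invf_lt1// (lt_trans ltr01).
have noise_ge0 : 0 <= L / 2 * (1 + eta^-1) * C by rewrite !mulr_ge0 ?invr_ge0.
have error_ge0 : 0 <= zeta / 2 + L / 2 * alpha 0 * (1 + eta).
  by rewrite addr_ge0 ?mulr_ge0 ?invr_ge0 ?addr_ge0// ltW.
have gap_ge0 k : 0 <= gap k by apply: Rintegral_ge0 => w _; rewrite subr_ge0.
have sqgrad_ge0 k : 0 <= sqgrad k by exact: expected_sqgrad_ge0.
have [C1 [C2 [C1_gt0 C2_gt0 sum_le]]] := descent_recursion_bound growth_ge0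
  decrease_gt0 noise_ge0 error_ge0 gap_ge0 sqgrad_ge0 alpha_gt0
  sum_sqr_le isgd_expected_descent.
exists C1, C2; split=> // K K_gt0.
have [k small] := exists_le_weighted_mean K_gt0 alpha_gt0 alphaS_le
  sqgrad_ge0 (sum_le K).
exists k; apply: le_trans small _.
by rewrite /LK mulrDl -!mulrA [_^-1 * _]mulrC.
Qed.

Lemma isgd_min_sqgrad_le : exists C1 C2 : R, 0 < C1 /\ 0 < C2 /\
  forall K : nat, (1 <= K)%N ->
    (\big[mine/+oo]_(k < K) \int[P]_w (sqnorm (gavg g (theta k w)))%:E
     <= (C1 / (K%:R * alpha K) + C2 * LK alpha eps K)%:E)%E.
Proof.
have [C1 [C2 [C1_gt0 C2_gt0 small]]] := isgd_exists_small_gradient.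
exists C1, C2; do 2 split=> //; move=> K /small[k le_k].
apply: le_trans (bigmin_le _ k _) _ => //.
have [_ isq] := (square_integrableP _ _).1 (isgd_gradient_square_integrable k).
by rewrite EFin_Rintegral.
Qed.

Lemma isgd_min_grad_cvg0 :
  (fun k : nat => (k%:R * alpha k)^-1) @ \oo --> 0 ->
  LK alpha eps @ \oo --> 0 ->
  (fun K : nat => \big[mine/+oo]_(k < K)
    \int[P]_w (enorm (gavg g (theta k w)))%:E)%E @ \oo --> 0%E.
Proof.
move=> cvg_alpha cvg_LK.
have [C1 [C2 [_ _ small]]] := isgd_exists_small_gradient.
pose bound K := C1 / (K%:R * alpha K) + C2 * LK alpha eps K.
have cvg_bound : bound @ \oo --> 0.
  have : bound @ \oo --> C1 * 0 + C2 * 0.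
    by apply: cvgD; [apply: cvgMl_tmp cvg_alpha|apply: cvgMl_tmp cvg_LK].
  by rewrite !mulr0 addr0.
apply: (bigmin_cvg0
  (u := fun k => (\int[P]_w (enorm (gavg g (theta k w)))%:E)%E)
  (b := fun K => Num.sqrt (bound K))).
- by move=> k; apply: integral_ge0 => w _; rewrite lee_fin enorm_ge0.
- by rewrite -sqrtr0; apply: continuous_cvg cvg_bound; exact: sqrt_continuous.
- move=> K /small[k le_k]; exists k.
  have [iE leE] := Rintegral_enorm_le (isgd_gradient_square_integrable k).
  by rewrite EFin_Rintegral// lee_fin (le_trans leE)// ler_wsqrtr.
Qed.

End Convergence.
End Iterates.
End RandomWeights.

Theorem mainTheorem3
  (R : realType) (d : measure_display) (Omega : measurableType d)
  (P : probability Omega R) (m n : nat)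
  (f : 'I_m -> 'rV[R]_n -> R) (g : 'I_m -> 'rV[R]_n -> 'rV[R]_n)
  (Lgrad finf A B C : R)
  (v : nat -> 'I_m -> {RV P >-> R})
  (e : nat -> 'rV[R]_m -> 'rV[R]_n -> 'rV[R]_n)
  (theta0 : 'rV[R]_n) (alpha eps : nat -> R) (eta zeta rho : R)
  (* (A1) *)
  (Hgrad : forall i, is_gradient (f i) (g i))
  (Hlipi : forall i, exists Li : R, euclid_lipschitz (g i) Li)
  (Hbndi : forall i, exists c : R, forall x, c <= f i x)
  (HL : euclid_lipschitz (gavg g) Lgrad)
  (Hfinf : forall x, finf <= favg f x)
  (HA : 0 <= A) (HB : 0 <= B) (HC : 0 <= C)
  (HABC : forall x,
     (\int[P]_w (sqnorm (gradv g (vrow v 0 w) x))%:E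
      <= (2 * A * (favg f x - finf) + B * sqnorm (gavg g x) + C)%:E)%E)
  (* the distribution D and the sampling *)
  (Hindep : mutually_independent (fun p : nat * 'I_m => v p.1 p.2))
  (Hlaw : forall k i, same_law (v k i) (v 0 i))
  (Hmean : forall i, ('E_P[v 0%N i] = 1%:E)%E)
  (Hsq : forall i, P.-integrable setT (fun w => (v 0 i w ^+ 2)%:E))
  (He_meas : forall k, borel_map (fun p : 'rV[R]_m * 'rV[R]_n => e k p.1 p.2))
  (* (A2) *)
  (Heps : forall k, 0 <= eps k)
  (HA2 : forall k (S : set 'rV[R]_n), borel_set S ->
     (\int[P]_(w in isgd g e v alpha theta0 k @^-1` S)
        (sqnorm (e k (vrow v k w) (isgd g e v alpha theta0 k w)))%:E
      <= (eps k ^+ 2)%:E * P (isgd g e v alpha theta0 k @^-1` S))%E)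
  (* (A3) *)
  (Hpos : forall k, 0 < alpha k)
  (Hnoninc : forall k, alpha k.+1 <= alpha k)
  (Hsum : cvg (series (fun k => alpha k ^+ 2) @ \oo))
  (Hka : (fun k : nat => (k%:R * alpha k)^-1) @ \oo --> 0)
  (* parameters *)
  (Heta : 0 < eta) (Hzeta : 2^-1 < zeta) (Hrho0 : 0 < rho) (Hrho1 : rho < 1)
  (Halpha0 : alpha 0 * (zeta * Lgrad * ((1 + eta) / eta * B))
             <= rho * (2 * zeta - 1)) :
  (exists C1 C2 : R, 0 < C1 /\ 0 < C2 /\
    forall K : nat, (1 <= K)%N ->
      (\big[mine/+oo]_(k < K)
          \int[P]_w (sqnorm (gavg g (isgd g e v alpha theta0 k w)))%:E
       <= (C1 / (K%:R * alpha K) + C2 * LK alpha eps K)%:E)%E)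
  /\
  (LK alpha eps @ \oo --> 0 ->
    (fun K : nat => \big[mine/+oo]_(k < K)
          \int[P]_w (enorm (gavg g (isgd g e v alpha theta0 k w)))%:E)%E
    @ \oo --> 0%E).
Proof.
(* In dimension 0 a Lipschitz constant may be negative. *)
pose L := Num.max Lgrad 0.
have L_ge0 : 0 <= L by rewrite le_max lexx orbT.
have lip_gavg : euclid_lipschitz (gavg g) L.
  by apply: euclid_lipschitzW HL; rewrite le_max lexx.
have alpha0_le : alpha 0 * (zeta * L * ((1 + eta) / eta * B)) <=
    rho * (2 * zeta - 1).
  rewrite /L; have [_|_] := leP Lgrad 0 => //.
  rewrite mulr0 mul0r mulr0 mulr_ge0 ?(ltW Hrho0)//; lra.
have err_le k : (\int[P]_w (sqnorm (e k (vrow v k w)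
    (isgd g e v alpha theta0 k w)))%:E <= (eps k ^+ 2)%:E)%E.
  have borelT : borel_set [set: 'rV[R]_n].
    by apply: sub_sigma_algebra; exact: openT.
  by have := HA2 k setT borelT; rewrite preimage_setT probability_setT mule1.
split.
  exact: (isgd_min_sqgrad_le Hindep Hlaw Hmean Hsq Hlipi lip_gavg He_meas
    err_le Hgrad L_ge0 Hfinf HA HB HC HABC Hpos Hnoninc Hsum Heta Hzeta Hrho1
    alpha0_le).
exact: (isgd_min_grad_cvg0 Hindep Hlaw Hmean Hsq Hlipi lip_gavg He_meas
  err_le Hgrad L_ge0 Hfinf HA HB HC HABC Hpos Hnoninc Hsum Heta Hzeta Hrho1
  alpha0_le Hka).
Qed.
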